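(* Over the base theory IZF, the Fan Theorem FAN does not imply Weak K\''onig's Lemma WKL; that is, WKL is not derivable in intuitionistic logic from $\mathrm{IZF} + \mathrm{FAN}$.
   Context: IZF is intuitionistic Zermelo--Fraenkel set theory. The meta-theory is ZFC. Let $\{0,1\}^{<\omega}$ be the set of finite binary sequences. An infinite path is a function $\alpha:\omega\to\{0,1\}$. A set $B\subseteq\{0,1\}^{<\omega}$ is a bar if every infinite path $\alpha$ has an initial segment in $B$. A bar $B$ is uniform if there is a natural number $n$ such that every infinite path has an initial segment of length at most $n$ in $B$. FAN (the full Fan Theorem) is the statement: every bar is uniform (no decidability assumption is made on the bar). A binary tree is a subset $T$ of $\{0,1\}^{<\omega}$ closed under initial segments. WKL is the statement: every infinite binary tree $T$ (one having members of every finite length) has an infinite path, i.e. there is $\alpha:\omega\to\{0,1\}$ all of whose finite initial segments lie in $T$. *)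

(* Defs.v *)
From HB Require Import structures.
From mathcomp Require Import all_boot.
Set Implicit Arguments. Unset Strict Implicit. Unset Printing Implicit Defensive.

(* First-order formulas over the signature {=, \in}. There are no function
   symbols, so terms are variables: de Bruijn indices, where the quantifiers
   bind index 0 and shift the remaining indices by one. *)
Inductive fm : Type :=
| fEq of nat & nat
| fIn of nat & nat
| fBot
| fAnd of fm & fm
| fOr of fm & fm
| fImp of fm & fm
| fAll of fm
| fEx of fm.

Lemma fm_comparable : comparable fm.
Proof. by move=> A B; rewrite /decidable; do !decide equality. Qed.

HB.instance Definition _ := hasDecEq.Build fm (compareP fm_comparable).

Declare Scope fm_scope.
Delimit Scope fm_scope with fm.
Bind Scope fm_scope with fm.

Notation "x = y" := (fEq x y) : fm_scope.
Notation "x \in y" := (fIn x y) : fm_scope.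
Notation "A /\ B" := (fAnd A B) : fm_scope.
Notation "A \/ B" := (fOr A B) : fm_scope.
Notation "A --> B" := (fImp A B) (at level 99, right associativity) : fm_scope.
Notation "A <-> B" := (fAnd (fImp A B) (fImp B A)) : fm_scope.
Notation "~ A" := (fImp A fBot) : fm_scope.

(* Bounded quantifiers: [x] lives outside the binder, [A] under it. *)
Definition fAllIn (x : nat) (A : fm) : fm := fAll (0 \in x.+1 --> A).
Definition fExIn (x : nat) (A : fm) : fm := fEx (0 \in x.+1 /\ A).

Definition up (r : nat -> nat) (n : nat) : nat :=
  if n is m.+1 then (r m).+1 else 0.

Fixpoint ren (r : nat -> nat) (A : fm) : fm :=
  match A with
  | fEq x y => fEq (r x) (r y)
  | fIn x y => fIn (r x) (r y)
  | fBot => fBot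
  | fAnd A B => fAnd (ren r A) (ren r B)
  | fOr A B => fOr (ren r A) (ren r B)
  | fImp A B => fImp (ren r A) (ren r B)
  | fAll A => fAll (ren (up r) A)
  | fEx A => fEx (ren (up r) A)
  end.

Definition shift : fm -> fm := ren succn.

(* [inst A x] is the body [A] of a quantifier with index 0 replaced by [x]. *)
Definition inst (A : fm) (x : nat) : fm :=
  ren (fun n => if n is m.+1 then m else x) A.

(* Intuitionistic natural deduction with equality from the nonlogical axioms
   [T]. An axiom may be used below any quantifier introduction, so axioms with
   free variables are understood as universally closed. *)
Inductive prv (T : fm -> Prop) : seq fm -> fm -> Prop :=
| prv_ax G A : T A -> prv T G A
| prv_hyp G A : A \in G -> prv T G A
| prv_botE G A : prv T G fBot -> prv T G A
| prv_andI G A B : prv T G A -> prv T G B -> prv T G (fAnd A B)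
| prv_andE1 G A B : prv T G (fAnd A B) -> prv T G A
| prv_andE2 G A B : prv T G (fAnd A B) -> prv T G B
| prv_orI1 G A B : prv T G A -> prv T G (fOr A B)
| prv_orI2 G A B : prv T G B -> prv T G (fOr A B)
| prv_orE G A B C :
    prv T G (fOr A B) -> prv T (A :: G) C -> prv T (B :: G) C -> prv T G C
| prv_impI G A B : prv T (A :: G) B -> prv T G (fImp A B)
| prv_impE G A B : prv T G (fImp A B) -> prv T G A -> prv T G B
| prv_allI G A : prv T (map shift G) A -> prv T G (fAll A)
| prv_allE G A x : prv T G (fAll A) -> prv T G (inst A x)
| prv_exI G A x : prv T G (inst A x) -> prv T G (fEx A)
| prv_exE G A C :
    prv T G (fEx A) -> prv T (A :: map shift G) (shift C) -> prv T G C
| prv_eqI G x : prv T G (fEq x x)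
| prv_eqE G A x y :
    prv T G (fEq x y) -> prv T G (inst A x) -> prv T G (inst A y).

Definition subsetF (x y : nat) : fm := fAllIn x (0 \in y.+1).

Definition isEmpty (x : nat) : fm := fAll (~ (0 \in x.+1)).

(* y = x \cup {x} *)
Definition isSucc (y x : nat) : fm :=
  fAll (0 \in y.+1 <-> (0 \in x.+1 \/ 0 = x.+1)).

Definition isInductive (x : nat) : fm :=
  fExIn x (isEmpty 0) /\ fAllIn x (fExIn x.+1 (isSucc 0 1)).

Definition Extensionality : fm :=
  fAll (fAll (fAll (0 \in 2 <-> 0 \in 1) --> 1 = 0)).

Definition Pairing : fm :=
  fAll (fAll (fEx (fAll (0 \in 1 <-> (0 = 3 \/ 0 = 2))))).

Definition Union : fm :=
  fAll (fEx (fAll (0 \in 1 <-> fExIn 2 (1 \in 0)))).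

Definition Powerset : fm :=
  fAll (fEx (fAll (0 \in 1 <-> subsetF 0 2))).

Definition Infinity : fm := fEx (isInductive 0).

(* In the schemas the indices of [A] are, innermost first:
   - Separation: the element, the given set, parameters;
   - Collection: the value, the argument, the given set, parameters;
   - Induction: the set, parameters.
   The renamings make [A] skip the binder it must not mention: the set being
   asserted to exist, resp. the outer bound variable of the induction step. *)
Definition Separation (A : fm) : fm :=
  fAll (fEx (fAll (0 \in 1 <-> (0 \in 2 /\ ren (up succn) A)))).

Definition Collection (A : fm) : fm :=
  fAll (fAllIn 0 (fEx A) -->
        fEx (fAllIn 1 (fExIn 1 (ren (up (up succn)) A)))).

Definition Induction (A : fm) : fm :=
  fAll (fAllIn 0 (ren (up succn) A) --> A) --> fAll A.

Inductive IZF : fm -> Prop :=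
| IZF_extensionality : IZF Extensionality
| IZF_pairing : IZF Pairing
| IZF_union : IZF Union
| IZF_powerset : IZF Powerset
| IZF_infinity : IZF Infinity
| IZF_separation A : IZF (Separation A)
| IZF_collection A : IZF (Collection A)
| IZF_induction A : IZF (Induction A).

Definition isOmega (w : nat) : fm :=
  isInductive w /\ fAll (isInductive 0 --> subsetF w.+1 0).

(* x = 0 or x = 1, with 0 = {} and 1 = {0} *)
Definition isBit (x : nat) : fm :=
  isEmpty x \/ fAll (0 \in x.+1 <-> isEmpty 0).

Definition isUPair (u a b : nat) : fm :=
  fAll (0 \in u.+1 <-> (0 = a.+1 \/ 0 = b.+1)).

(* Kuratowski pairs: p = {{a}, {a, b}} *)
Definition isOPair (p a b : nat) : fm :=
  fEx (fEx (isUPair 1 a.+2 a.+2 /\ isUPair 0 a.+2 b.+2 /\ isUPair p.+2 1 0)).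

(* (a, b) \in f *)
Definition maps (f a b : nat) : fm := fExIn f (isOPair 0 a.+1 b.+1).

(* f is a function from d to {0, 1} *)
Definition isBinFun (f d : nat) : fm :=
  fAllIn f (fExIn d.+1 (fEx (isBit 0 /\ isOPair 2 1 0)))
  /\ fAllIn d (fEx (maps f.+2 1 0))
  /\ fAll (fAll (fAll (maps f.+3 2 1 --> maps f.+3 2 0 --> 1 = 0))).

(* s is the restriction of the function f to n *)
Definition isRestr (s f n : nat) : fm :=
  fAll (0 \in s.+1 <-> (0 \in f.+1 /\ fExIn n.+1 (fEx (isOPair 2 1 0)))).

(* Below, [w] is the index of a variable denoting omega. Natural numbers are
   the elements of omega, a binary sequence of length n is a function from n
   to {0, 1}, and an infinite path is a function from omega to {0, 1}. *)
Definition isFinSeq (w s : nat) : fm := fExIn w (isBinFun s.+1 0).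

(* B contains the initial segment of length n of f *)
Definition hitsAt (B f n : nat) : fm := fExIn B (isRestr 0 f.+1 n.+1).

Definition isBar (w B : nat) : fm :=
  fAllIn B (isFinSeq w.+1 0)
  /\ fAll (isBinFun 0 w.+1 --> fExIn w.+1 (hitsAt B.+2 1 0)).

Definition isUniform (w B : nat) : fm :=
  fExIn w (fAll (isBinFun 0 w.+2 -->
    fExIn w.+2 ((0 \in 2 \/ 0 = 2) /\ hitsAt B.+3 1 0))).

Definition FAN : fm :=
  fAll (isOmega 0 --> fAll (isBar 1 0 --> isUniform 1 0)).

Definition isTree (w T : nat) : fm :=
  fAllIn T (isFinSeq w.+1 0)
  /\ fAllIn T (fAllIn w.+1 (fAll (isRestr 0 2 1 --> 0 \in T.+3))).

Definition isInfinite (w T : nat) : fm := fAllIn w (fExIn T.+1 (isBinFun 0 1)).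

Definition hasPath (w T : nat) : fm :=
  fEx (isBinFun 0 w.+1 /\
       fAllIn w.+1 (fAll (isRestr 0 2 1 --> 0 \in T.+3))).

Definition WKL : fm :=
  fAll (isOmega 0 --> fAll (isTree 1 0 /\ isInfinite 1 0 --> hasPath 1 0)).

(* Main.v *)
Require Import Defs.
From mathcomp Require Import all_boot.
From Stdlib Require Import ClassicalEpsilon.
Set Implicit Arguments. Unset Strict Implicit. Unset Printing Implicit Defensive.

(** The proof is a topological model. For a topological space X, the truth
    value of a formula is an open set of X: conjunction, disjunction and
    existence are read pointwise, implication and universal quantification take
    the interior of their pointwise reading. Sets are interpreted by names, that
    is, well-founded trees whose edges carry an extent of membership. Derivations
    are sound for this reading ([soundness]), and every axiom of IZF holds at
    every point of every space ([sat_IZF]).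

    FAN holds in the model over every space ([sat_FAN]). If B is a bar at p,
    then every classical path alpha has a name which is a path everywhere, so
    the finite sequences that lie in B at p form a classical bar. The classical
    fan theorem gives a uniform bound N for it. That N is a bound is a condition
    on the finitely many sequences of length N only, hence it holds on an open
    neighbourhood of p; at any point of it, an internal path takes classical
    values, so N bounds the length at which it meets B.

    WKL fails over a convergent sequence, the space consisting of isolated
    points 0, 1, 2, ... and their limit ([not_sat_hasPath]). Take a tree with
    the two branches 0000... and 1111..., where the node of length n on branch b
    is in the tree except at the isolated points k < n with the parity of b.
    Each point k only excludes one of the branches, so the tree has members of
    every length everywhere. A path at the limit has its first value b on a
    whole neighbourhood of the limit, thus at some isolated k of parity b; there
    it would have to follow branch b, which stops at length k. The classical
    pattern at work is that each open set [on_branch b n] is a neighbourhood of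
    the limit, while their intersection over n is not. *)

(** * Topological spaces *)

(** A topology presented by its interior operator, the form in which it enters
    the clauses for implication and universal quantification. *)
Record space := Space {
  pt :> Type;
  int : (pt -> Prop) -> pt -> Prop;
  int_sub : forall P p, int P p -> P p;
  int_mono : forall P Q p, (forall q, P q -> Q q) -> int P p -> int Q p;
  int_int : forall P p, int P p -> int (int P) p;
  int_and : forall P Q p, int P p -> int Q p -> int (fun q => P q /\ Q q) p;
  int_true : forall p, int (fun=> True) p }.

Section Model.
Variable X : space.
Implicit Types (P Q K L : X -> Prop) (p q : X).

Definition open K := forall p, K p -> int K p.

Lemma open_true : open (fun=> True).
Proof. by move=> p _; apply: int_true. Qed.

Lemma open_false : open (fun=> False).
Proof. by []. Qed.

Lemma open_int P : open (int P).
Proof. by move=> p; apply: int_int. Qed.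

Lemma open_and K L : open K -> open L -> open (fun q => K q /\ L q).
Proof. by move=> oK oL p [Kp Lp]; apply: int_and; [apply: oK|apply: oL]. Qed.

Lemma open_or K L : open K -> open L -> open (fun q => K q \/ L q).
Proof.
move=> oK oL p [/oK|/oL]; apply: int_mono => q; [by left|by right].
Qed.

Lemma open_ex I (K : I -> X -> Prop) :
  (forall i, open (K i)) -> open (fun q => exists i, K i q).
Proof. by move=> oK p [i /oK]; apply: int_mono => q Kq; exists i. Qed.

(** The introduction rules below replace the unfolding of interiors: a statement
    holds near a point as soon as it follows, at each point, from open
    conditions that hold at the given one. *)
Lemma intI0 P p : (forall q, P q) -> int P p.
Proof. by move=> PP; apply: int_mono (int_true p) => q. Qed.

Lemma intI1 K P p : K p -> open K -> (forall q, K q -> P q) -> int P p.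
Proof. by move=> Kp oK KP; apply: int_mono (oK _ Kp). Qed.

Lemma intI2 K L P p : K p -> L p -> open K -> open L ->
  (forall q, K q -> L q -> P q) -> int P p.
Proof.
move=> Kp Lp oK oL KP.
by apply: (intI1 (K := fun q => K q /\ L q)) => [//||q []]; [apply: open_and|exact: KP].
Qed.

Lemma intI3 K L M P p : K p -> L p -> M p -> open K -> open L -> open M ->
  (forall q, K q -> L q -> M q -> P q) -> int P p.
Proof.
move=> Kp Lp Mp oK oL oM KP.
apply: (intI2 (K := fun q => K q /\ L q) (L := M)) => //; first exact: open_and.
by move=> q []; apply: KP.
Qed.

(** * Names for sets *)

(** [Nm A el ev] names the set whose elements are the sets named by the [el a],
    each to the extent [ev a]. The extent may be any subset of the space; only
    its interior will count. *)
Inductive name : Type := Nm (A : Type) (el : A -> name) (ev : A -> X -> Prop).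

Definition ix x := let: Nm A _ _ := x in A.
Definition el x : ix x -> name := let: Nm _ f _ := x in f.
Definition ev x : ix x -> X -> Prop := let: Nm _ _ e := x in fun a => int (e a).

(** Extensional equality. It is made open by a single interior on the outside,
    and thereby agrees with nested implications; this is [eqn_ext]. *)
Fixpoint eqn (x y : name) {struct x} : X -> Prop :=
  let: Nm A f e := x in
  int (fun p =>
    (forall a : A, int (e a) p -> exists b : ix y, ev b p /\ eqn (f a) (el b) p) /\
    (forall b : ix y, ev b p -> exists a : A, int (e a) p /\ eqn (f a) (el b) p)).

Definition mem (x y : name) : X -> Prop :=
  fun p => exists b : ix y, ev b p /\ eqn x (el b) p.

Lemma open_ev x (a : ix x) : open (ev a).
Proof. by case: x a => A f e a; apply: open_int. Qed.

Lemma open_eqn x y : open (eqn x y).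
Proof. by case: x => A f e; apply: open_int. Qed.

Lemma open_mem x y : open (mem x y).
Proof. by apply: open_ex => b; apply: open_and; [apply: open_ev|apply: open_eqn]. Qed.

Lemma eqn_refl x p : eqn x x p.
Proof.
elim: x p => A f IH e p /=; apply: intI0 => q.
by split=> a Ha; exists a; split=> //; apply: IH.
Qed.

Lemma eqn_sym x y p : eqn x y p -> eqn y x p.
Proof.
elim: x y p => A f IH e [B g d] p /=; apply: int_mono => q [H1 H2].
by split=> [b /H2|a /H1] [c [Hc E]]; exists c; split=> //; apply: IH.
Qed.

Lemma eqn_trans x y z p : eqn x y p -> eqn y z p -> eqn x z p.
Proof.
elim: x y z p => A f IH e [B g d] [C h k] p /= Hxy Hyz.
apply: (intI2 Hxy Hyz); try exact: open_int.
move=> q /int_sub[H1 H2] /int_sub[H3 H4]; split=> a.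
  by case/H1=> b [/H3[c [Hc Ec]] Eb]; exists c; split=> //; apply: IH Eb Ec.
by case/H4=> b [/H2[c [Hc Ec]] Eb]; exists c; split=> //; apply: IH Ec Eb.
Qed.

Lemma mem_eql x x' y p : eqn x x' p -> mem x y p -> mem x' y p.
Proof.
by move=> /eqn_sym E [b [Hb Eb]]; exists b; split=> //; apply: eqn_trans E Eb.
Qed.

Lemma mem_ev x (a : ix x) p : ev a p -> mem (el a) x p.
Proof. by move=> Ha; exists a; split=> //; apply: eqn_refl. Qed.

(** This is what makes equality a congruence for membership, and it reduces
    every equality proof to a comparison of elements. *)
Lemma eqn_ext x y p : eqn x y p <-> int (fun q => forall z, mem z x q <-> mem z y q) p.
Proof.
split; case: x => A f e.
  move=> E; apply: (intI1 E) => [|q /int_sub[H1 H2] z]; first exact: open_int.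
  split=> -[a [Ha Ea]].
    by case: (H1 a Ha) => b [Hb Eb]; exists b; split=> //; apply: eqn_trans Ea Eb.
  case: (H2 a Ha) => b [Hb Eb]; exists b; split=> //.
  by apply: eqn_trans Ea _; apply: eqn_sym.
apply: int_mono => q H; split=> a Ha.
  exact/H/(@mem_ev (Nm f e)).
have/H[b [Hb Eb]] := mem_ev Ha.
by exists b; split=> //; apply: eqn_sym.
Qed.

Lemma mem_eqr x y y' p : eqn y y' p -> mem x y p -> mem x y' p.
Proof. by move=> /eqn_ext/int_sub H /H. Qed.

(** * Satisfaction and soundness *)

Definition scons (x : name) (r : nat -> name) (n : nat) : name :=
  if n is m.+1 then r m else x.

Fixpoint sat (A : fm) (r : nat -> name) : X -> Prop :=
  match A with
  | fEq i j => eqn (r i) (r j)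
  | fIn i j => mem (r i) (r j)
  | fBot => fun=> False
  | fAnd A B => fun p => sat A r p /\ sat B r p
  | fOr A B => fun p => sat A r p \/ sat B r p
  | fImp A B => int (fun p => sat A r p -> sat B r p)
  | fAll A => int (fun p => forall x, sat A (scons x r) p)
  | fEx A => fun p => exists x, sat A (scons x r) p
  end.

Lemma open_sat A r : open (sat A r).
Proof.
elim: A r => [i j|i j||A IA B IB|A IA B IB|A IA B IB|A IA|A IA] r /=;
  try exact: open_int.
- exact: open_eqn.
- exact: open_mem.
- exact: open_false.
- exact: open_and.
- exact: open_or.
- exact: open_ex.
Qed.

Lemma sat_ren A f r s p :
  (forall n, s n = r (f n)) -> sat (ren f A) r p <-> sat A s p.
Proof.
elim: A f r s p => [i j|i j||A IA B IB|A IA B IB|A IA B IB|A IA|A IA] f r s p E /=;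
  try by rewrite ?E.
- by rewrite (IA _ _ _ _ E) (IB _ _ _ _ E).
- by rewrite (IA _ _ _ _ E) (IB _ _ _ _ E).
- by split; apply: int_mono => q; rewrite (IA _ _ _ _ E) (IB _ _ _ _ E).
- have E' x n : scons x s n = scons x r (up f n) by case: n => //=.
  by split; apply: int_mono => q H x; have := H x; rewrite (IA _ _ _ _ (E' x)).
- have E' x n : scons x s n = scons x r (up f n) by case: n => //=.
  by split=> -[x H]; exists x; move: H; rewrite (IA _ _ _ _ (E' x)).
Qed.

(** The environments have to agree near [p] and not just at [p], because
    equality of infinitely many entries is not an open condition. *)
Lemma sat_eqn A r s p :
  int (fun q => forall n, eqn (r n) (s n) q) p -> sat A r p -> sat A s p.
Proof.
elim: A r s p => [i j|i j||A IA B IB|A IA B IB|A IA B IB|A IA|A IA] r s p E /=.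
- have H := int_sub E; move=> Eij.
  by apply: eqn_trans (H j); apply: eqn_trans Eij; apply: eqn_sym.
- have H := int_sub E; move=> Mij.
  by apply: mem_eqr (H j) _; apply: mem_eql (H i) _.
- by [].
- by case=> HA HB; split; [apply: IA E HA|apply: IB E HB].
- by case=> [HA|HB]; [left; apply: IA E HA|right; apply: IB E HB].
- move=> H; apply: (intI2 E H); try exact: open_int.
  move=> q Eq /int_sub Hq HA; apply: IB (Eq) _; apply: Hq; apply: IA HA.
  by apply: int_mono Eq => q' Eq' n; apply: eqn_sym.
- move=> H; apply: (intI2 E H); try exact: open_int.
  move=> q Eq /int_sub Hq x; apply: IA (Hq x).
  by apply: int_mono Eq => q' Eq' [|n] //=; apply: eqn_refl.
- case=> x Hx; exists x; apply: IA Hx.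
  by apply: int_mono E => q' Eq' [|n] //=; apply: eqn_refl.
Qed.

Lemma sat_subst A r x y p :
  eqn x y p -> sat A (scons x r) p -> sat A (scons y r) p.
Proof.
move=> E; apply: sat_eqn; apply: (intI1 E); first exact: open_eqn.
by move=> q Eq [|n] //=; apply: eqn_refl.
Qed.

Lemma sat_inst A x r p : sat (inst A x) r p <-> sat A (scons (r x) r) p.
Proof. by apply: sat_ren => -[|n]. Qed.

Lemma sat_shift A x r p : sat (shift A) (scons x r) p <-> sat A r p.
Proof. exact: sat_ren. Qed.

Fixpoint sat_ctx (G : seq fm) r p :=
  if G is A :: G' then sat A r p /\ sat_ctx G' r p else True.

Lemma open_sat_ctx G r : open (sat_ctx G r).
Proof.
elim: G => [|A G IG]; first exact: open_true.
by apply: open_and; first exact: open_sat.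
Qed.

Lemma sat_ctx_shift G x r p : sat_ctx G r p -> sat_ctx (map shift G) (scons x r) p.
Proof. by elim: G => //= A G IG [HA /IG HG]; split=> //; apply/sat_shift. Qed.

Lemma sat_ctx_mem G A r p : A \in G -> sat_ctx G r p -> sat A r p.
Proof.
elim: G => //= B G IG; rewrite inE => /orP[/eqP->|/IG H]; first by case.
by case.
Qed.

Lemma soundness (T : fm -> Prop) G A :
  (forall B, T B -> forall r p, sat B r p) ->
  prv T G A -> forall r p, sat_ctx G r p -> sat A r p.
Proof.
move=> HT; elim=> {G A} /=.
- by move=> G A /HT H r p _.
- by move=> G A HA r p; apply: sat_ctx_mem.
- by move=> G A _ IH r p /IH.
- by move=> G A B _ IA _ IB r p HG; split; [apply: IA|apply: IB].
- by move=> G A B _ IH r p /IH[].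
- by move=> G A B _ IH r p /IH[].
- by move=> G A B _ IH r p /IH; left.
- by move=> G A B _ IH r p /IH; right.
- move=> G A B C _ IAB _ IA _ IB r p HG.
  by case: (IAB r p HG) => H; [apply: IA|apply: IB].
- move=> G A B _ IH r p HG; apply: (intI1 HG); first exact: open_sat_ctx.
  by move=> q Gq Aq; apply: IH.
- by move=> G A B _ IAB _ IA r p HG; apply: (int_sub (IAB r p HG)); apply: IA.
- move=> G A _ IH r p HG; apply: (intI1 HG); first exact: open_sat_ctx.
  by move=> q Gq x; apply/IH/sat_ctx_shift.
- by move=> G A x _ IH r p /IH/int_sub/(_ (r x)) H; apply/sat_inst.
- by move=> G A x _ IH r p /IH/sat_inst H; exists (r x).
- move=> G A C _ IA _ IC r p HG; case: (IA r p HG) => x Hx.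
  by apply/(sat_shift C x)/IC; split=> //; apply: sat_ctx_shift.
- by move=> G x r p _; apply: eqn_refl.
- move=> G A x y _ IE _ IA r p HG; apply/sat_inst.
  by apply: sat_subst (IE r p HG) _; apply/sat_inst/IA.
Qed.

(** * The axioms of IZF *)

(** Most defined notions of set theory have the form: x is the set of all z with
    phi(z). Such a formula says that x equals any name y with these elements.
    The hypothesis is needed only near the point, so y may depend on it. *)
Lemma eqn_spec (phi : name -> X -> Prop) x y p :
  int (fun q => forall z, mem z y q <-> phi z q) p ->
  int (fun q => forall z, int (fun q' => mem z x q' -> phi z q') q /\
                          int (fun q' => phi z q' -> mem z x q') q) p
  <-> eqn x y p.
Proof.
move=> Hy; split=> [Hx|E].
  apply/eqn_ext; apply: (intI2 Hx Hy); try exact: open_int.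
  move=> q /int_sub H1 /int_sub H2 z; rewrite H2.
  by have [/int_sub ? /int_sub ?] := H1 z.
apply: (intI2 E Hy); [exact: open_eqn|exact: open_int|].
move=> q Eq Hq z; split; apply: (intI2 Eq Hq); try exact: open_eqn;
  try exact: open_int; move=> q' Eq' /int_sub Hq'.
  by move=> /(mem_eqr Eq')/Hq'.
by move=> /Hq'; apply/mem_eqr/eqn_sym.
Qed.

Lemma eqn_spec0 (phi : name -> X -> Prop) x y p :
  (forall z q, mem z y q <-> phi z q) ->
  int (fun q => forall z, int (fun q' => mem z x q' -> phi z q') q /\
                          int (fun q' => phi z q' -> mem z x q') q) p
  <-> eqn x y p.
Proof. by move=> H; apply: eqn_spec; apply: intI0 => q z. Qed.

Lemma sat_fAll_valid A r p :
  (forall q x, sat A (scons x r) q) -> sat (fAll A) r p.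
Proof. by move=> H; apply: intI0. Qed.

Lemma sat_fImp_valid A B r p :
  (forall q, sat A r q -> sat B r q) -> sat (fImp A B) r p.
Proof. by move=> H; apply: intI0. Qed.

Lemma sat_fAllIn i A r p :
  sat (fAllIn i A) r p <->
  int (fun q => forall x, mem x (r i) q -> sat A (scons x r) q) p.
Proof.
split=> H; apply: (intI1 H) => [|q Hq x]; try exact: open_int.
  exact: int_sub (int_sub Hq x).
apply: (intI1 Hq) => [|q' /int_sub Hq']; [exact: open_int|exact: Hq'].
Qed.

Definition emptyN : name := Nm (fun e : Empty_set => match e with end)
                             (fun _ _ => True).

Definition pairN (x y : name) : name :=
  Nm (fun b : bool => if b then x else y) (fun _ _ => True).

Definition succN (x : name) : name :=
  Nm (fun o : option (ix x) => if o is Some a then el a else x)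
     (fun o => if o is Some a then ev a else fun=> True).

Definition unionN (x : name) : name :=
  Nm (fun s : {a : ix x & ix (el a)} => el (projT2 s))
     (fun s p => ev (projT1 s) p /\ ev (projT2 s) p).

Definition sepN (x : name) (phi : ix x -> X -> Prop) : name :=
  Nm (@el x) (fun a p => ev a p /\ phi a p).

(** A subset u of [x] equals [x] with the extent of each element cut down to
    that of its membership in u, so families of extents yield all subsets. *)
Definition powN (x : name) : name :=
  Nm (fun phi : ix x -> X -> Prop => sepN phi) (fun _ _ => True).

Lemma mem_emptyN z p : ~ mem z emptyN p.
Proof. by case=> -[]. Qed.

Lemma mem_pairN x y z p : mem z (pairN x y) p <-> eqn z x p \/ eqn z y p.
Proof.
split=> [[[] [_ /= E]]|[]E]; [by left|by right|exists true|exists false];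
  by split=> //; apply: int_true.
Qed.

Lemma mem_succN x z p : mem z (succN x) p <-> mem z x p \/ eqn z x p.
Proof.
split=> [[[a|] [/int_sub /= Ha Ea]]|[[a [Ha Ea]]|E]].
- by left; exists a.
- by right.
- by exists (Some a); split=> //; apply: open_ev Ha.
- by exists None; split=> //; apply: int_true.
Qed.

Lemma mem_unionN x z p :
  mem z (unionN x) p <-> exists y, mem y x p /\ mem z y p.
Proof.
split=> [[[a b] [/int_sub /= [Ha Hb] E]]|[y [[a [Ha Ea]] /(mem_eqr Ea)[b [Hb Eb]]]]].
  by exists (el a); split; [apply: mem_ev|exists b].
by exists (existT _ a b); split=> //; apply: int_and; apply: open_ev.
Qed.

Lemma mem_sepN x (phi : name -> X -> Prop) z p :
  (forall a, open (phi a)) ->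
  (forall a b q, eqn a b q -> phi a q -> phi b q) ->
  mem z (sepN (fun a : ix x => phi (el a))) p <-> mem z x p /\ phi z p.
Proof.
move=> ophi ephi; split=> [[a [/int_sub /= [Ha Pa] E]]|[[a [Ha Ea]] Pz]].
  by split; [exists a|apply: ephi Pa; apply: eqn_sym].
exists a; split=> //; apply: int_and; first exact: open_ev.
by apply: ophi; apply: ephi Pz.
Qed.

Lemma mem_powN x z p :
  mem z (powN x) p <-> int (fun q => forall u, int (fun q' => mem u z q' -> mem u x q') q) p.
Proof.
split=> [[phi [_ /= E]]|H].
  apply: (intI1 E) => [|q Eq u]; first exact: open_eqn.
  apply: (intI1 Eq) => [|q' Eq' /(mem_eqr Eq') [a [/int_sub /= [Ha _] Ea]]].
    exact: open_eqn.
  by exists a.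
exists (fun a => mem (el a) z); split; first exact: int_true.
apply/eqn_ext; apply: (intI1 H) => [|q /int_sub Hq u]; first exact: open_int.
have -> := @mem_sepN x (mem^~ z) u q (fun a => @open_mem a z)
  (fun a b q' => @mem_eql a b z q').
by split=> [Hu|[]//]; split=> //; apply: int_sub (Hq u) _.
Qed.

Lemma sat_isEmpty i r p : sat (isEmpty i) r p <-> eqn (r i) emptyN p.
Proof.
rewrite -(@eqn_spec0 (fun _ _ => False)); last first.
  by move=> z q; split=> // /mem_emptyN.
split; apply: int_mono => q H z; last by case: (H z).
by split; [exact: H|apply: intI0].
Qed.

Lemma sat_isSucc i j r p : sat (isSucc i j) r p <-> eqn (r i) (succN (r j)) p.
Proof. exact/eqn_spec0/mem_succN. Qed.

Lemma sat_isUPair i j k r p :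
  sat (isUPair i j k) r p <-> eqn (r i) (pairN (r j) (r k)) p.
Proof. exact/eqn_spec0/mem_pairN. Qed.

(** The von Neumann numerals; every natural number of the model is, at each
    point, one of them, by [mem_omegaN]. *)
Fixpoint num (n : nat) : name := if n is m.+1 then succN (num m) else emptyN.

Definition omegaN : name := Nm num (fun _ _ => True).

Lemma mem_omegaN z p : mem z omegaN p <-> exists n, eqn z (num n) p.
Proof.
by split=> [[n [_ E]]|[n E]]; exists n => //; split=> //; apply: int_true.
Qed.

Lemma eqn_succN x y p : eqn x y p -> eqn (succN x) (succN y) p.
Proof.
move=> E; apply/eqn_ext; apply: (intI1 E) => [|q Eq z]; first exact: open_eqn.
rewrite !mem_succN.
split=> -[H|H]; first [by left; apply: mem_eqr H => //; apply: eqn_sym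
  |right; apply: eqn_trans H _ => //; exact: eqn_sym].
Qed.

Lemma sat_inductive_omegaN i r p :
  eqn (r i) omegaN p -> sat (isInductive i) r p.
Proof.
move=> E; split.
  exists emptyN; split; last by apply/sat_isEmpty; apply: eqn_refl.
  by apply: mem_eqr (eqn_sym E) _; apply/mem_omegaN; exists 0; apply: eqn_refl.
apply: (intI1 E) => [|q Eq x]; first exact: open_eqn.
apply: (intI1 Eq) => [|q' Eq' /(mem_eqr Eq') /mem_omegaN [n En]].
  exact: open_eqn.
exists (num n.+1); split.
  by apply: mem_eqr (eqn_sym Eq') _; apply/mem_omegaN; exists n.+1; apply: eqn_refl.
by apply/sat_isSucc; apply: eqn_succN; apply: eqn_sym.
Qed.

Lemma sat_inductive_num i r n p : sat (isInductive i) r p -> mem (num n) (r i) p.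
Proof.
case=> [[x [Hx /sat_isEmpty Ex]] /int_sub IH].
elim: n => [|n /(int_sub (IH (num n)))[y [Hy /sat_isSucc Ey]]].
  exact: mem_eql Hx.
exact: mem_eql Hy.
Qed.

Lemma sat_isOmega i r p : sat (isOmega i) r p <-> eqn (r i) omegaN p.
Proof.
split=> [[Hi /int_sub Hm]|E].
  have Ho : sat (isInductive 0) (scons omegaN r) p.
    by apply: sat_inductive_omegaN; apply: eqn_refl.
  have Hs := int_sub (Hm omegaN) Ho.
  have {}Hi : sat (isInductive i) r p by [].
  apply/eqn_ext; apply: (intI2 Hi Hs); [exact: open_sat|exact: open_int|].
  move=> q Hq /int_sub Sq z; split; first exact: int_sub (Sq z).
  by case/mem_omegaN=> n /eqn_sym En; apply: mem_eql En _; apply: sat_inductive_num.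
split; first exact: sat_inductive_omegaN.
apply: (intI1 E) => [|q Eq y]; first exact: open_eqn.
apply: (intI1 Eq) => [|q1 Eq1 Hy]; first exact: open_eqn.
have {}Hy : sat (isInductive 0) (scons y r) q1 by [].
apply: (intI2 Eq1 Hy); [exact: open_eqn|exact: open_sat|move=> q2 Eq2 Hy2 z].
apply: (intI2 Eq2 Hy2); [exact: open_eqn|exact: open_sat|move=> q3 Eq3 Hy3].
move=> /(mem_eqr Eq3)/mem_omegaN[n /eqn_sym En].
by apply: mem_eql En _; apply: (sat_inductive_num _ Hy3).
Qed.

Lemma sat_up_succ A x y r p :
  sat (ren (up succn) A) (scons x (scons y r)) p <-> sat A (scons x r) p.
Proof. by apply: sat_ren => -[|n]. Qed.

Lemma sat_Extensionality r p : sat Extensionality r p.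
Proof.
apply: sat_fAll_valid => {}p x; apply: sat_fAll_valid => {}p y; apply: sat_fImp_valid => {}p.
exact: (eqn_spec0 (phi := fun z => mem z y) x p _).1.
Qed.

Lemma sat_Pairing r p : sat Pairing r p.
Proof.
apply: sat_fAll_valid => {}p x; apply: sat_fAll_valid => {}p y; exists (pairN x y).
exact/(eqn_spec0 _ _ (mem_pairN x y))/eqn_refl.
Qed.

Lemma sat_Union r p : sat Union r p.
Proof.
apply: sat_fAll_valid => {}p x; exists (unionN x).
exact/(eqn_spec0 _ _ (mem_unionN x))/eqn_refl.
Qed.

Lemma sat_Powerset r p : sat Powerset r p.
Proof.
apply: sat_fAll_valid => {}p x; exists (powN x).
exact/(eqn_spec0 _ _ (mem_powN x))/eqn_refl.
Qed.

Lemma sat_Infinity r p : sat Infinity r p.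
Proof. by exists omegaN; apply: sat_inductive_omegaN; apply: eqn_refl. Qed.

Lemma sat_Separation A r p : sat (Separation A) r p.
Proof.
apply: sat_fAll_valid => {}p x.
pose S := sepN (fun a : ix x => sat A (scons (el a) (scons x r))).
exists S; apply: (eqn_spec0 (y := S) _ _ _).2; last exact: eqn_refl.
move=> z q; rewrite [X in _ <-> _ /\ X]sat_up_succ.
by apply: (@mem_sepN x (fun a => sat A (scons a (scons x r)))) => *;
  [apply: open_sat|apply: sat_subst; eassumption].
Qed.

(** The existential quantifier is pointwise, so witnesses are chosen for each
    pair of an element of [x] and a point. All of them are put into one name,
    with full extent: collection allows superfluous members. *)
Lemma sat_Collection A r p : sat (Collection A) r p.
Proof.
apply: sat_fAll_valid => {}p x; apply: sat_fImp_valid => {}p /sat_fAllIn H.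
pose R (a : ix x) q b := sat A (scons b (scons (el a) (scons x r))) q.
pose w (aq : ix x * X) := epsilon (inhabits emptyN) (R aq.1 aq.2).
exists (Nm w (fun _ _ => True)); apply/sat_fAllIn.
apply: (intI1 H) => [|q /int_sub Hq a [c [Hc Ec]]]; first exact: open_int.
have Hw : R c q (w (c, q)).
  by apply: (epsilon_spec _ (R c q)); apply: (Hq _ (mem_ev Hc)).
exists (w (c, q)); split.
  by exists (c, q); split; [apply: int_true|apply: eqn_refl].
rewrite (@sat_ren _ _ _ (scons (w (c, q)) (scons a (scons x r)))); last first.
  by case=> [|[|n]].
apply: sat_eqn Hw; apply: (intI1 Ec) => [|q' E]; first exact: open_eqn.
by case=> [|[|n]] /=; [apply: eqn_refl|apply: eqn_sym|apply: eqn_refl].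
Qed.

(** The hypothesis of the induction is an open condition, and the induction on
    names is carried out at all points of it at once. *)
Lemma sat_Induction A r p : sat (Induction A) r p.
Proof.
apply: sat_fImp_valid => {}p H; apply: (intI1 H) => [|{H}p H x]; first exact: open_int.
elim: x p H => B f IH e p H; apply: (int_sub (int_sub H (Nm f e))).
apply/sat_fAllIn; apply: (intI1 H) => [|q Hq y [b [_ /eqn_sym Eb]]].
  exact: open_int.
by apply/sat_up_succ; apply: sat_subst Eb _; apply: IH Hq.
Qed.

Lemma sat_IZF A r p : IZF A -> sat A r p.
Proof.
by case=> [|||||B|B|B]; [apply: sat_Extensionality|apply: sat_Pairing
  |apply: sat_Union|apply: sat_Powerset|apply: sat_Infinity
  |apply: sat_Separation|apply: sat_Collection|apply: sat_Induction].
Qed.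

(** * Pairs and binary functions *)

Lemma sat_fAll_intro K A r p : K p -> open K ->
  (forall q x, K q -> sat A (scons x r) q) -> sat (fAll A) r p.
Proof. by move=> Kp oK H; apply: (intI1 Kp oK) => q Kq x; apply: H. Qed.

Lemma sat_fImp_intro K A B r p : K p -> open K ->
  (forall q, K q -> sat A r q -> sat B r q) -> sat (fImp A B) r p.
Proof. by move=> Kp oK H; apply: (intI1 Kp oK). Qed.

Lemma sat_fAnd A B r p : sat (fAnd A B) r p = (sat A r p /\ sat B r p).
Proof. by []. Qed.

Lemma sat_fEx A r p : sat (fEx A) r p = exists x, sat A (scons x r) p.
Proof. by []. Qed.

Lemma sat_fAll_elim A r p x : sat (fAll A) r p -> sat A (scons x r) p.
Proof. by move=> /int_sub/(_ x). Qed.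

Lemma sat_fImp_elim A B r p : sat (fImp A B) r p -> sat A r p -> sat B r p.
Proof. by move=> /int_sub. Qed.

(** Infinite intersections of open sets need not be open. The finite ones are
    taken over the arguments of a finite restriction of a path, and over the
    binary sequences of a given length. *)
Lemma open_ball (T : finType) (K : T -> X -> Prop) :
  (forall t, open (K t)) -> open (fun q => forall t, K t q).
Proof.
move=> oK p Kp.
suff: int (fun q => forall t, t \in enum T -> K t q) p.
  by apply: int_mono => q H t; apply: H; rewrite mem_enum.
elim: (enum T) => [|t s IH]; first exact: intI0.
apply: (intI2 (oK t p (Kp t)) IH); [exact: open_int|exact: open_int|].
move=> q /int_sub Ht /int_sub Hs u; rewrite inE => /orP[/eqP->//|]; exact: Hs.
Qed.

Definition opairN x y := pairN (pairN x x) (pairN x y).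

Lemma eqn_pairN x y x' y' p :
  eqn x x' p -> eqn y y' p -> eqn (pairN x y) (pairN x' y') p.
Proof.
move=> Ex Ey; apply/eqn_ext; apply: (intI2 Ex Ey); try exact: open_eqn.
move=> q {}Ex {}Ey z; rewrite !mem_pairN.
by split=> -[] E; [left|right|left|right]; apply: eqn_trans E _ => //; apply: eqn_sym.
Qed.

Lemma eqn_opairN x y x' y' p :
  eqn x x' p -> eqn y y' p -> eqn (opairN x y) (opairN x' y') p.
Proof. by move=> Ex Ey; do !apply: eqn_pairN. Qed.

Lemma pairN_inj x y x' y' p : eqn (pairN x y) (pairN x' y') p ->
  (eqn x x' p /\ eqn y y' p) \/ (eqn x y' p /\ eqn y x' p).
Proof.
move=> /eqn_ext/int_sub H.
have Hx : mem x (pairN x' y') p.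
  by apply/H; apply/mem_pairN; left; apply: eqn_refl.
have Hy : mem y (pairN x' y') p.
  by apply/H; apply/mem_pairN; right; apply: eqn_refl.
have Hx' : mem x' (pairN x y) p.
  by apply/H; apply/mem_pairN; left; apply: eqn_refl.
have Hy' : mem y' (pairN x y) p.
  by apply/H; apply/mem_pairN; right; apply: eqn_refl.
move: Hx Hy Hx' Hy'; rewrite !mem_pairN => -[Ex|Ex] [Ey|Ey] [Ex'|Ex'] [Ey'|Ey'];
 by [left; split=> //; apply: eqn_sym|right; split=> //; apply: eqn_sym
  |left; split=> //; apply: eqn_trans Ey _; apply: eqn_trans (eqn_sym Ex) _; apply: eqn_sym
  |right; split=> //; apply: eqn_trans Ey _; apply: eqn_trans (eqn_sym Ex) _; apply: eqn_sym].
Qed.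

Lemma opairN_inj x y x' y' p :
  eqn (opairN x y) (opairN x' y') p -> eqn x x' p /\ eqn y y' p.
Proof.
have dup a b c : eqn (pairN a a) (pairN b c) p -> eqn a b p /\ eqn a c p.
  by move=> /pairN_inj[[]|[]].
move=> /pairN_inj[[/dup[Ex _] /pairN_inj[[_ Ey]|[E1 E2]]]|[/dup[Ex Exy] E]].
- by [].
- by split=> //; apply: eqn_trans E2 _; apply: eqn_trans (eqn_sym Ex) E1.
- split=> //; have [E1 E2] := dup _ _ _ (eqn_sym E).
  by apply: eqn_trans (eqn_sym E2) _; apply: eqn_trans (eqn_sym Ex) Exy.
Qed.

Lemma sat_isOPair i j k r p :
  sat (isOPair i j k) r p <-> eqn (r i) (opairN (r j) (r k)) p.
Proof.
split=> [[x [y [/sat_isUPair Ex [/sat_isUPair Ey /sat_isUPair E]]]]|E].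
  exact: eqn_trans E (eqn_pairN Ex Ey).
exists (pairN (r j) (r j)), (pairN (r j) (r k)).
by split; [|split]; apply/sat_isUPair => //; apply: eqn_refl.
Qed.

Lemma sat_maps i j k r p :
  sat (maps i j k) r p <-> mem (opairN (r j) (r k)) (r i) p.
Proof.
split=> [[z [Hz /sat_isOPair E]]|H]; first exact: mem_eql E Hz.
by exists (opairN (r j) (r k)); split=> //; apply/sat_isOPair/eqn_refl.
Qed.

Lemma sat_isBit i r p : sat (isBit i) r p <-> exists b : bool, eqn (r i) (num b) p.
Proof.
have H1 : sat (fAll (0 \in i.+1 <-> isEmpty 0)) r p <-> eqn (r i) (num 1) p.
  apply: (eqn_spec0 (phi := fun z => sat (isEmpty 0) (scons z r))) => z q.
  rewrite mem_succN sat_isEmpty.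
  by split=> [[/mem_emptyN|]|]; [|by []|right].
split=> [[/sat_isEmpty|/H1] E|[[] E]]; first by exists false.
- by exists true.
- by right; apply/H1.
- by left; apply/sat_isEmpty.
Qed.

(** Well-foundedness of names; it separates the numerals. *)
Lemma mem_irrefl x p : ~ mem x x p.
Proof.
elim: x => A f IH e [a [Ha Ea]]; apply: (IH a).
exact: mem_eqr Ea (@mem_ev (Nm f e) a p Ha).
Qed.

Lemma mem_num z n p : mem z (num n) p <-> exists i, i < n /\ eqn z (num i) p.
Proof.
elim: n => [|n IH] /=; first by split=> [/mem_emptyN|[i []]].
rewrite mem_succN IH; split=> [[[i [lt_in E]]|E]|[i [lt_in E]]].
- by exists i; split=> //; apply: leqW.
- by exists n.
- move: lt_in; rewrite ltnS leq_eqVlt => /orP[/eqP Ei|lt_in].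
    by right; rewrite -Ei.
  by left; exists i.
Qed.

Lemma num_inj m n p : eqn (num m) (num n) p -> m = n.
Proof.
wlog lt_mn : m n / m < n.
  by move=> H E; case: (ltngtP m n) => // lt; [apply: H|symmetry; apply: H (eqn_sym E)].
move=> E; case: (@mem_irrefl (num m) p); apply: mem_eqr (eqn_sym E) _.
by apply/mem_num; exists m; split=> //; apply: eqn_refl.
Qed.

Lemma num_bool_inj (b c : bool) p : eqn (num b) (num c) p -> b = c.
Proof. by move/num_inj; case: b c => [] []. Qed.

(** [d] is, near the point, the set of the numerals in [D]. This treats omega
    and its elements, the two kinds of domains of binary functions, alike. *)
Definition natdom (D : nat -> Prop) d : X -> Prop :=
  int (fun q => forall z, mem z d q <-> exists i, D i /\ eqn z (num i) q).

(** [f] is, near the point, a function from the numerals in [D] to bits, with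
    the arguments and the values read off as classical numbers. *)
Definition natfun (D : nat -> Prop) f : X -> Prop :=
  int (fun q =>
    [/\ forall z, mem z f q ->
          exists i (b : bool), D i /\ eqn z (opairN (num i) (num b)) q,
        forall i, D i -> exists b : bool, mem (opairN (num i) (num b)) f q
      & forall i (b c : bool), mem (opairN (num i) (num b)) f q ->
          mem (opairN (num i) (num c)) f q -> b = c]).

Lemma natdom_omega d p : eqn d omegaN p -> natdom (fun=> True) d p.
Proof.
move=> E; apply: (intI1 E) => [|q Eq z]; first exact: open_eqn.
split=> [/(mem_eqr Eq)/mem_omegaN[n En]|[n [_ En]]]; first by exists n.
by apply: mem_eqr (eqn_sym Eq) _; apply/mem_omegaN; exists n.
Qed.

Lemma natdom_num d n p : eqn d (num n) p -> natdom (fun i => i < n) d p.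
Proof.
move=> E; apply: (intI1 E) => [|q Eq z]; first exact: open_eqn.
by rewrite -mem_num; split; apply: mem_eqr => //; apply: eqn_sym.
Qed.

(** At each point the elements of the domain are numerals and the bits are
    classical, so the formula reduces to an external condition. *)
Lemma sat_isBinFun D i j r p :
  natdom D (r j) p -> sat (isBinFun i j) r p <-> natfun D (r i) p.
Proof.
rewrite /isBinFun !sat_fAnd => Hd; split.
  case=> /sat_fAllIn H1 [/sat_fAllIn H2 H3].
  apply: (intI1 (K := fun q => _ /\ _ /\ _ /\ _) (conj Hd (conj H1 (conj H2 H3)))).
    by do ?apply: open_and; apply: open_int.
  move=> q [/int_sub {}Hd [/int_sub {}H1 [/int_sub {}H2 {}H3]]]; split.
  - move=> z /H1[a [/Hd[k [Dk Ek]] [b [/sat_isBit[c Ec] /sat_isOPair Ez]]]].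
    by exists k, c; split=> //; apply: eqn_trans Ez _; apply: eqn_opairN.
  - move=> k Dk; have /H2[b /sat_maps Hb] : mem (num k) (r j) q.
      by apply/Hd; exists k; split=> //; apply: eqn_refl.
    have /H1[a [_ [b' [/sat_isBit[c Ec] /sat_isOPair Ez]]]] := Hb.
    exists c; apply: mem_eql Hb; apply: eqn_opairN; first exact: eqn_refl.
    by apply: eqn_trans Ec; have [] := opairN_inj Ez.
  - move=> k b c Hb Hc; apply: (@num_bool_inj _ _ q).
    have H := sat_fAll_elim (num c) (sat_fAll_elim (num b) (sat_fAll_elim (num k) H3)).
    by apply: (sat_fImp_elim (sat_fImp_elim H _)); apply/sat_maps.
move=> Hf; split; [|split].
- apply/sat_fAllIn; apply: (intI2 Hd Hf); try exact: open_int.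
  move=> q /int_sub {}Hd /int_sub[{}Hf _ _] z /Hf [k [b [Dk Ez]]].
  exists (num k); split; first by apply/Hd; exists k; split=> //; apply: eqn_refl.
  exists (num b); split; last exact/sat_isOPair.
  by apply/sat_isBit; exists b; apply: eqn_refl.
- apply/sat_fAllIn; apply: (intI2 Hd Hf); try exact: open_int.
  move=> q /int_sub {}Hd /int_sub[_ {}Hf _] z /Hd[k [/Hf[b Hb] Ek]].
  exists (num b); apply/sat_maps; apply: mem_eql Hb.
  by apply: eqn_opairN; [apply: eqn_sym|apply: eqn_refl].
- apply: (sat_fAll_intro Hf) => [|q a {}Hf]; first exact: open_int.
  apply: (sat_fAll_intro Hf) => [|{}q b {}Hf]; first exact: open_int.
  apply: (sat_fAll_intro Hf) => [|{}q c {}Hf]; first exact: open_int.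
  apply: (sat_fImp_intro Hf) => [|{}q {}Hf Hb]; first exact: open_int.
  apply: (sat_fImp_intro (K := fun q => natfun D (r i) q /\
    sat (maps i.+3 2 1) (scons c (scons b (scons a r))) q)) => [//||{}q [{}Hf {}Hb] Hc].
    by apply: open_and; [apply: open_int|apply: open_sat].
  move/sat_maps: Hb => Hb; move/sat_maps: Hc => Hc; have [H1 _ H2] := int_sub Hf.
  have [k [b' [Dk /opairN_inj[/= Eak Eb]]]] := H1 _ Hb.
  have [k' [c' [_ /opairN_inj[/= Eak' Ec]]]] := H1 _ Hc.
  have Ebc : b' = c'.
    apply: (H2 k); first exact: mem_eql (eqn_opairN Eak Eb) Hb.
    by apply: mem_eql Hc; apply: eqn_opairN.
  by apply: eqn_trans Eb _; rewrite Ebc; apply: eqn_sym.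
Qed.

(** Classical functions as names: the graph of [alpha] on [D], with full extent
    everywhere. *)
Definition graphN (D : nat -> Prop) (alpha : nat -> bool) : name :=
  Nm (fun i => opairN (num i) (num (alpha i))) (fun i _ => D i).

Lemma mem_graphN D alpha z p : mem z (graphN D alpha) p <->
  exists i, D i /\ eqn z (opairN (num i) (num (alpha i))) p.
Proof.
split=> [[i [/int_sub Di E]]|[i [Di E]]]; first by exists i.
by exists i; split=> //; apply: intI0.
Qed.

Lemma mem_opairN_graphN D alpha i (b : bool) p :
  mem (opairN (num i) (num b)) (graphN D alpha) p <-> D i /\ alpha i = b.
Proof.
rewrite mem_graphN; split=> [[j [Dj /opairN_inj[/num_inj -> /num_bool_inj ->]]] //|].
by case=> Di <-; exists i; split=> //; apply: eqn_refl.
Qed.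

Lemma eqn_graphN D alpha D' alpha' p :
  eqn (graphN D alpha) (graphN D' alpha') p <->
  forall i b, D i /\ alpha i = b <-> D' i /\ alpha' i = b.
Proof.
split=> [/eqn_ext/int_sub E i b|E]; first by rewrite -!(mem_opairN_graphN _ _ _ _ p).
apply/eqn_ext; apply: intI0 => q z; rewrite !mem_graphN.
split=> -[i [Di Ez]]; exists i.
  by have [? ->] := (E i (alpha i)).1 (conj Di erefl).
by have [? ->] := (E i (alpha' i)).2 (conj Di erefl).
Qed.

Lemma natfun_graphN D alpha p : natfun D (graphN D alpha) p.
Proof.
apply: intI0 => q; split=> [z /mem_graphN[i [Di E]]|i Di|i b c].
- by exists i, (alpha i).
- by exists (alpha i); apply/mem_opairN_graphN.
- by move=> /mem_opairN_graphN[_ <-] /mem_opairN_graphN[_ <-].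
Qed.

(** The values may differ from point to point; only finitely many of them can
    be relied upon in a common neighbourhood. *)
Lemma natfun_val D f p : natfun D f p ->
  exists alpha : nat -> bool,
    forall i, D i -> mem (opairN (num i) (num (alpha i))) f p.
Proof.
move=> /int_sub[_ H _].
exists (fun i => epsilon (inhabits false)
  (fun b : bool => mem (opairN (num i) (num b)) f p)) => i Di.
by apply: (epsilon_spec _ (fun b : bool => mem (opairN (num i) (num b)) f p)); apply: H.
Qed.

Lemma natfun_eqn D f g p : eqn f g p -> natfun D f p -> natfun D g p.
Proof.
move=> E H; apply: (intI2 E H) => [||q Eq /int_sub[H1 H2 H3]];
  [exact: open_eqn|exact: open_int|split].
- by move=> z /(mem_eqr (eqn_sym Eq)); apply: H1.
- by move=> i /H2[b Hb]; exists b; apply: mem_eqr Eq Hb.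
- move=> i b c /(mem_eqr (eqn_sym Eq)) Hb /(mem_eqr (eqn_sym Eq)).
  exact: H3 Hb.
Qed.

(** If near the point [alpha] gives the values of a function on [E], then its
    restriction to [E] is a graph of [alpha] there. Agreement at the point alone
    would not do: equality of names speaks of a whole neighbourhood. *)
Lemma sat_isRestr D E (alpha : nat -> bool) i j k r p :
  natfun D (r j) p -> natdom E (r k) p ->
  int (fun q => forall n, D n -> E n ->
         mem (opairN (num n) (num (alpha n))) (r j) q) p ->
  sat (isRestr i j k) r p <-> eqn (r i) (graphN (fun n => D n /\ E n) alpha) p.
Proof.
move=> Hf Hd Ha; apply: eqn_spec.
apply: (intI3 Hf Hd Ha); try exact: open_int.
move=> q /int_sub[H1 _ H3] /int_sub {}Hd /int_sub {}Ha z; rewrite mem_graphN; split.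
  case=> n [[Dn En] Ez]; split.
    by apply: mem_eql (eqn_sym Ez) _; apply: Ha.
  exists (num n); split; first by apply/Hd; exists n; split=> //; apply: eqn_refl.
  by exists (num (alpha n)); apply/sat_isOPair.
case=> Hz [a [/Hd[n [En Ean]] [b /sat_isOPair /= Ez]]].
have [m [c [Dm Ez']]] := H1 z Hz.
have [Eam _] := opairN_inj (eqn_trans (eqn_sym Ez) Ez').
have Emn : m = n by apply: (@num_inj _ _ q); apply: eqn_trans (eqn_sym Eam) Ean.
subst m; exists n; split=> //.
suff -> : alpha n = c by [].
by apply: (H3 n); [apply: Ha|apply: mem_eql Ez' Hz].
Qed.

Definition seqN (s : seq bool) : name := graphN (fun i => i < size s) (nth false s).

Lemma eqn_seqN s t p : eqn (seqN s) (seqN t) p -> s = t.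
Proof.
move=> /eqn_graphN H.
have lt_eq i : (i < size s) = (i < size t).
  apply/idP/idP => lt; first by have [] := (H i (nth false s i)).1 (conj lt erefl).
  by have [] := (H i (nth false t i)).2 (conj lt erefl).
have sz : size s = size t.
  by apply/eqP; rewrite eqn_leq leqNgt lt_eq ltnn leqNgt -lt_eq ltnn.
apply: (@eq_from_nth _ false) => // i lt.
by have [] := (H i (nth false s i)).1 (conj lt erefl).
Qed.

Lemma sat_isRestr_seqN s n i j k r p :
  eqn (r j) (seqN s) p -> eqn (r k) (num n) p ->
  sat (isRestr i j k) r p <-> eqn (r i) (seqN (take n s)) p.
Proof.
move=> Ej Ek.
rewrite (@sat_isRestr (fun m => m < size s) (fun m => m < n) (nth false s)).
- suff H : eqn (graphN (fun m => m < size s /\ m < n) (nth false s)) (seqN (take n s)) p.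
    split=> E; apply: eqn_trans E _ => //; exact: eqn_sym.
  apply/eqn_graphN => m b; rewrite size_take_min leq_min.
  split=> [[[ms mn] <-]|[/andP[mn ms] <-]]; rewrite nth_take //.
  by rewrite ms mn.
- by apply: natfun_eqn (eqn_sym Ej) _; apply: natfun_graphN.
- exact: natdom_num.
- apply: (intI1 Ej) => [|q Eq m lt_m _]; first exact: open_eqn.
  by apply: mem_eqr (eqn_sym Eq) _; apply/mem_opairN_graphN.
Qed.

(** The values of an internal path at a single point determine its restriction
    to [n] near that point, because only finitely many values are involved. *)
Lemma sat_isRestr_path (alpha : nat -> bool) n i j k r p :
  natfun (fun=> True) (r j) p -> eqn (r k) (num n) p ->
  (forall m, m < n -> mem (opairN (num m) (num (alpha m))) (r j) p) ->
  sat (isRestr i j k) r p <-> eqn (r i) (seqN (mkseq alpha n)) p.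
Proof.
move=> Hf Ek Ha.
rewrite (@sat_isRestr (fun=> True) (fun m => m < n) alpha) //; last 2 first.
- exact: natdom_num.
- suff: int (fun q => forall m : 'I_n,
      mem (opairN (num m) (num (alpha m))) (r j) q) p.
    by apply: int_mono => q H m _ lt_m; apply: (H (Ordinal lt_m)).
  by apply: open_ball => [m|m]; [apply: open_mem|apply: Ha].
suff H : eqn (graphN (fun m => True /\ m < n) alpha) (seqN (mkseq alpha n)) p.
  split=> E; apply: eqn_trans E _ => //; exact: eqn_sym.
apply/eqn_graphN => m b; rewrite size_mkseq.
by split=> [[[_ lt] <-]|[lt <-]]; rewrite nth_mkseq.
Qed.

(** * The fan theorem *)

(** The classical compactness argument: if no bound worked for the extensions of
    the root, then no bound would work for those of one of its children, and so
    on along a path that the bar would never meet. *)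
Lemma fan_theorem (P : seq bool -> Prop) :
  (forall alpha : nat -> bool, exists n, P (mkseq alpha n)) ->
  exists N, forall t, N <= size t -> exists n, n <= N /\ P (take n t).
Proof.
move=> bar.
pose unif s := exists N, forall t, N <= size t ->
  exists n, n <= size s + N /\ P (take n (s ++ t)).
suff: unif [::] by case=> N H; exists N.
have split_unif s : unif (rcons s false) -> unif (rcons s true) -> unif s.
  case=> N0 H0 [N1 H1]; exists (maxn N0 N1).+1 => -[|b t] //= lt.
  rewrite ltnS geq_max in lt; case/andP: lt => lt0 lt1.
  have /(_ b) H : forall b, exists n,
      n <= (size s).+1 + maxn N0 N1 /\ P (take n (rcons s b ++ t)).
    case; [have [n [le_n Pn]] := H1 t lt1|have [n [le_n Pn]] := H0 t lt0];
    exists n; split=> //; rewrite size_rcons in le_n; apply: leq_trans le_n _;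
    by rewrite leq_add2l ?leq_maxl ?leq_maxr.
  by rewrite -cat_rcons addnS -addSn.
case: (classic (unif [::])) => // not_unif.
pose next s := if excluded_middle_informative (unif (rcons s false)) then true else false.
have next_bad s : ~ unif s -> ~ unif (rcons s (next s)).
  by rewrite /next; case: excluded_middle_informative => // H H' /(split_unif _ H).
pose branch n := iter n (fun s => rcons s (next s)) [::].
have bad n : ~ unif (branch n) by elim: n => //= n; apply: next_bad.
have branchE n : branch n = mkseq (next \o branch) n.
  by elim: n => //= n IH; rewrite mkseqS -IH.
have [n Pn] := bar (next \o branch).
case: (bad n); exists 0 => t _; exists n; rewrite branchE size_mkseq addn0; split=> //.
by rewrite take_cat size_mkseq ltnn subnn take0 cats0.
Qed.

(** Being a uniform bound [N] for the stalk of a bar is an open condition. *)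
Lemma sat_FAN r p : sat FAN r p.
Proof.
apply: sat_fAll_valid => {}p w; apply: sat_fImp_valid => {}p /sat_isOmega Ew.
apply: (sat_fAll_intro Ew) => [|{}p B {}Ew]; first exact: open_eqn.
apply: (sat_fImp_intro Ew) => [|{}p {}Ew]; first exact: open_eqn.
rewrite /isBar sat_fAnd => -[_ bar].
have [N HN] : exists N, forall t, N <= size t ->
    exists n, n <= N /\ mem (seqN (take n t)) B p.
  apply: (fan_theorem (P := fun s => mem (seqN s) B p)) => alpha.
  have Hf := natfun_graphN (fun=> True) alpha p.
  have [|x [Hx [s [Hs Es]]]] :=
    sat_fImp_elim (sat_fAll_elim (graphN (fun=> True) alpha) bar).
    by apply/sat_isBinFun; first exact: natdom_omega.
  have [n En] := (mem_omegaN _ _).1 (mem_eqr Ew Hx).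
  exists n; apply: mem_eql Hs.
  apply: (@sat_isRestr_path alpha n 0 2 1 _ p Hf En _).1 Es => m _.
  exact/mem_opairN_graphN.
(* Quantifying over the finitely many [t] of length [N], and not over paths,
   makes [K] open. *)
pose K q := forall t : N.-tuple bool,
  exists n, n <= N /\ mem (seqN (take n t)) B q.
have oK : open K.
  apply: open_ball => t; apply: open_ex => n.
  by apply: open_and; [move=> q ?; apply: intI0|apply: open_mem].
have Kp : K p by move=> t; apply: HN; rewrite size_tuple.
have omega_num q n : eqn w omegaN q -> mem (num n) w q.
  move=> Ewq; apply: mem_eqr (eqn_sym Ewq) _.
  by apply/mem_omegaN; exists n; apply: eqn_refl.
exists (num N); split; first exact: omega_num.
pose C q := K q /\ eqn w omegaN q.
have oC : open C by apply: open_and => //; apply: open_eqn.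
apply: (sat_fAll_intro (K := C)) => // {HN Kp Ew bar}p f Cp.
apply: (sat_fImp_intro Cp) => // {Cp}p [Kp Ew].
rewrite sat_isBinFun; last exact: natdom_omega.
move=> Hf; have [alpha Ha] := natfun_val Hf.
have [n [le_nN Hn]] := Kp (mktuple (fun i : 'I_N => alpha i)).
exists (num n); split; first exact: omega_num.
split.
  move: le_nN; rewrite leq_eqVlt => /orP[/eqP->|lt_nN].
    by right; apply: eqn_refl.
  by left; apply/mem_num; exists n; split=> //; apply: eqn_refl.
exists (seqN (mkseq alpha n)); split; last first.
  apply/(sat_isRestr_path (alpha := alpha) (n := n)) => //.
  - exact: eqn_refl.
  - by move=> m _; apply: Ha.
  - exact: eqn_refl.
suff -> : mkseq alpha n = take n (mktuple (fun i : 'I_N => alpha i)) by [].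
apply: (@eq_from_nth _ false); first by rewrite size_mkseq size_takel ?size_tuple.
move=> i; rewrite size_mkseq => lt_in.
rewrite nth_mkseq // nth_take //.
have lt_iN := leq_trans lt_in le_nN.
by rewrite (nth_mktuple _ _ (Ordinal lt_iN)).
Qed.

End Model.

(** * A tree without path over the convergent sequence *)

(** The interior in the one-point compactification of the discrete space of
    natural numbers, [None] being the point at infinity. *)
Definition seq_int (P : option nat -> Prop) (x : option nat) : Prop :=
  P x /\ (x = None -> exists m, forall k, m <= k -> P (Some k)).

Definition conv_seq : space.
Proof.
refine (@Space (option nat) seq_int _ _ _ _ _) => [P x|P Q x PQ|P x|P Q x|x].
- by case.
- by case=> Px H; split=> [|/H[m Hm]]; [apply: PQ|exists m => k /Hm; apply: PQ].
- by case=> Px H; split=> // /H[m Hm]; exists m => k /Hm.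
- case=> Px HP [Qx HQ]; split=> // E; have [m Hm] := HP E; have [n Hn] := HQ E.
  exists (maxn m n) => k; rewrite geq_max => /andP[mk nk].
  by split; [apply: Hm|apply: Hn].
- by split=> // _; exists 0.
Defined.

(** The extent to which the node of length [n] on branch [b] is in the tree: it
    is lost at an isolated point [k] of the parity of [b] once [n] exceeds [k]. *)
Definition on_branch (b : bool) (n : nat) (x : conv_seq) : Prop :=
  if x is Some k then k < n -> odd k <> b else True.

Lemma open_on_branch b n : open (on_branch b n).
Proof.
by case=> [k|] Hx; split=> // _; exists n => k /leq_gtF lt; rewrite /= lt.
Qed.

(** Internally, the tree of all constant sequences allowed by [on_branch]. It
    is not decidable at infinity. *)
Definition treeN : name conv_seq :=
  Nm (fun bn : bool * nat => seqN conv_seq (nseq bn.2 bn.1))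
     (fun bn => on_branch bn.1 bn.2).

Lemma mem_treeN z x : mem z treeN x <->
  exists b n, on_branch b n x /\ eqn z (seqN conv_seq (nseq n b)) x.
Proof.
split=> [[[b n] [/int_sub H E]]|[b [n [H E]]]]; first by exists b, n.
by exists (b, n); split=> //; apply: (@open_on_branch b n).
Qed.

Lemma sat_isBinFun_seqN (X : space) s n i j r (p : X) :
  eqn (r i) (seqN X s) p -> eqn (r j) (num X n) p -> size s = n ->
  sat (isBinFun i j) r p.
Proof.
move=> Ei Ej ?; subst n; apply/(sat_isBinFun _ (natdom_num Ej)).
by apply: natfun_eqn (eqn_sym Ei) _; apply: natfun_graphN.
Qed.

Lemma sat_isTree r x : sat (isTree 1 0) (scons treeN (scons (omegaN _) r)) x.
Proof.
rewrite /isTree sat_fAnd; split; apply/sat_fAllIn; apply: intI0 => {}x t.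
  move=> /mem_treeN[b [n [_ E]]]; exists (num _ n); split.
    by apply/mem_omegaN; exists n; apply: eqn_refl.
  by apply: (sat_isBinFun_seqN E (eqn_refl (num _ n) x)); rewrite size_nseq.
move=> Ht; apply/sat_fAllIn; apply: (intI1 Ht) => [|{}x {}Ht n Hn]; first exact: open_mem.
pose C y := mem t treeN y /\ mem n (omegaN _) y.
have oC : open C by apply: open_and; apply: open_mem.
apply: (sat_fAll_intro (K := C)) => // {Ht Hn}x s Cx.
apply: (sat_fImp_intro Cx) => // {Cx}x [/mem_treeN[b [m [Hb Et]]] /mem_omegaN[k En]].
move=> /(sat_isRestr_seqN (s := nseq m b) (n := k)) Es.
apply/mem_treeN; exists b, (minn k m); split.
  by case: x Hb {Et En Es} => //= j H; rewrite leq_min => /andP[_ /H].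
suff <- : take k (nseq m b) = nseq (minn k m) b by apply: Es.
case: leqP => [le_km|lt_mk]; first by rewrite take_nseq.
by rewrite take_oversize // size_nseq ltnW.
Qed.

(** An isolated point cannot have both parities, so one branch survives. *)
Lemma sat_isInfinite r x :
  sat (isInfinite 1 0) (scons treeN (scons (omegaN _) r)) x.
Proof.
apply/sat_fAllIn; apply: intI0 => {}x n /mem_omegaN[k En].
have [b Hb] : exists b, on_branch b k x.
  by case: x {En} => [j|]; [exists (~~ odd j) => _; case: (odd j)|exists true].
exists (seqN _ (nseq k b)); split.
  by apply/mem_treeN; exists b, k; split=> //; apply: eqn_refl.
by apply: (sat_isBinFun_seqN (eqn_refl (seqN _ (nseq k b)) x) En); rewrite size_nseq.
Qed.

(** The first value [b] of a path at infinity is kept at some isolated point [k]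
    of parity [b], where branch [b] stops at length [k]. *)
Lemma not_sat_hasPath r :
  ~ sat (hasPath 1 0) (scons treeN (scons (omegaN _) r)) (None : conv_seq).
Proof.
rewrite /hasPath sat_fEx => -[f]; rewrite sat_fAnd => -[].
rewrite (sat_isBinFun _ (natdom_omega (eqn_refl (omegaN _) _))) => Hf Hpath.
have [_ Hval _] := int_sub Hf; have {Hval}[b Hb] := Hval 0 I.
pose K x := (natfun (fun=> True) f x /\ mem (opairN (num _ 0) (num _ b)) f x) /\
  sat (fAllIn 2 (fAll (isRestr 0 2 1 --> 0 \in 3)))
      (scons f (scons treeN (scons (omegaN conv_seq) r))) x.
have oK : open K.
  by apply: open_and; [apply: open_and; [apply: open_int|apply: open_mem]|apply: open_sat].
have [_ /(_ erefl)[m Hm]] := oK _ (conj (conj Hf Hb) Hpath).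
(* An isolated point close to infinity with the parity of [b]. *)
pose k := m.*2 + b.
have [|{Hf Hb}[Hf Hb] {Hpath}/sat_fAllIn/int_sub Hpath] := Hm k.
  by rewrite /k -addnn -addnA leq_addr.
have odd_k : odd k = b by rewrite /k oddD odd_double; case: (b).
have [alpha Ha] := natfun_val Hf.
have alpha0 : alpha 0 = b by have [_ _ H] := int_sub Hf; apply: (H 0) => //; apply: Ha.
have Hn : mem (num _ k.+1) (omegaN conv_seq) (Some k).
  by apply/mem_omegaN; exists k.+1; apply: eqn_refl.
have Hs := sat_fImp_elim (sat_fAll_elim (seqN _ (mkseq alpha k.+1)) (Hpath _ Hn)).
have {Hs}/mem_treeN[c [n [Hc /eqn_seqN E]]] :
    mem (seqN _ (mkseq alpha k.+1)) treeN (Some k : conv_seq).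
  apply: Hs; apply/(sat_isRestr_path (alpha := alpha) (n := k.+1)) => //.
  - exact: eqn_refl.
  - by move=> i _; apply: Ha.
  - exact: eqn_refl.
have En : n = k.+1 by have := congr1 size E; rewrite size_mkseq size_nseq.
have Ec : c = b by have := congr1 (nth c ^~ 0) E; rewrite nth_mkseq // nth_nseq En /= alpha0.
by apply: Hc; rewrite ?En // odd_k Ec.
Qed.

Theorem theorem1 : ~ prv (fun A => IZF A \/ A = FAN) [::] WKL.
Proof.
move=> H; pose r (n : nat) := emptyN conv_seq.
have wkl : sat WKL r None.
  by apply: (soundness _ H) => // B [HB|->] s y; [apply: sat_IZF|apply: sat_FAN].
have {}wkl := sat_fImp_elim (sat_fAll_elim (omegaN conv_seq) wkl).
apply: (@not_sat_hasPath r).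
apply: sat_fImp_elim (sat_fAll_elim treeN (wkl _)) _.
  by apply/sat_isOmega; apply: eqn_refl.
by rewrite sat_fAnd; split; [apply: sat_isTree|apply: sat_isInfinite].
Qed.
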